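(* Let $A$ and $B$ be self-adjoint operators on the same complex Hilbert space, and suppose that $B$ is bounded, non-negative, and non-zero. Then the set $\mathbb{R} \setminus \bigcup_{t\in\mathbb{R}}\sigma(A+tB)$ is discrete, that is, it is at most countable and contains none of its accumulation points. In particular, the union $\bigcup_{t\in\mathbb{R}}\sigma(A+tB)$ is dense in $\mathbb{R}$. Conversely, for every discrete set $P \subset \mathbb{R}$ (i.e. at most countable and containing none of its accumulation points), there exist self-adjoint operators $A$ and $B$ on some Hilbert space, with $B$ bounded and non-negative, such that $P = \mathbb{R} \setminus \bigcup_{t\in\mathbb{R}}\sigma(A+tB)$.
   Context: $\sigma(T)$ denotes the spectrum of an operator $T$. $A$ may be unbounded; $A+tB$ is defined on the domain of $A$. *)

(* Defs.v *)
From mathcomp Require Import all_boot all_order all_algebra.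
From mathcomp Require Import complex.
From mathcomp Require Import boolp classical_sets cardinality reals.
Set Implicit Arguments. Unset Strict Implicit. Unset Printing Implicit Defensive.
Import Order.TTheory GRing.Theory Num.Theory.
Local Open Scope ring_scope.
Local Open Scope classical_set_scope.

Section Hilbert.
Variable R : realType.
Local Notation C := (R[i]).
Variable V : lmodType C.
Variable ip : V -> V -> C.   (* inner product <x, y>, linear in x *)

Definition nsq (x : V) : C := ip x x.

Definition is_hilbert : Prop :=
  [/\ (forall (a : C) (x y z : V), ip (a *: x + y) z = a * ip x z + ip y z),
      (forall x y : V, ip y x = Num.conj (ip x y)),
      (forall x : V, 0 <= ip x x),
      (forall x : V, ip x x = 0 -> x = 0) &
      (forall u : nat -> V,
         (forall e : C, 0 < e -> exists N, forall m n, (N <= m)%N -> (N <= n)%N ->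
             nsq (u m - u n) < e) ->
         exists l : V, forall e : C, 0 < e -> exists N, forall n, (N <= n)%N ->
             nsq (u n - l) < e)].

Definition subspace (D : set V) : Prop :=
  D 0 /\ forall (a : C) x y, D x -> D y -> D (a *: x + y).

Definition dense (D : set V) : Prop :=
  forall (x : V) (e : C), 0 < e -> exists2 y, D y & nsq (x - y) < e.

(* an (unbounded) linear operator with domain D, represented by a map T
   whose values outside D are irrelevant *)
Definition lin_on (D : set V) (T : V -> V) : Prop :=
  subspace D /\ forall (a : C) x y, D x -> D y -> T (a *: x + y) = a *: T x + T y.

Definition bounded_op (T : V -> V) : Prop :=
  (forall (a : C) x y, T (a *: x + y) = a *: T x + T y) /\
  exists M : C, forall x, nsq (T x) <= M * nsq x.

Definition adj_dom (D : set V) (T : V -> V) : set V :=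
  [set y | exists z : V, forall x, D x -> ip (T x) y = ip x z].

Definition self_adjoint (D : set V) (T : V -> V) : Prop :=
  [/\ lin_on D T, dense D,
      (forall y, adj_dom D T y <-> D y) &
      (forall x y, D x -> D y -> ip (T x) y = ip x (T y))].

Definition in_resolvent (D : set V) (T : V -> V) (lam : C) : Prop :=
  exists S : V -> V, [/\ bounded_op S,
     (forall x, D (S x) /\ T (S x) - lam *: S x = x) &
     (forall x, D x -> S (T x - lam *: x) = x)].

Definition spectrum (D : set V) (T : V -> V) : set C :=
  [set lam | ~ in_resolvent D T lam].

Definition nonneg_op (T : V -> V) : Prop := forall x, 0 <= ip (T x) x.

End Hilbert.

(* R \ U_{t in R} sigma(A + t B)  (A + tB has domain D = dom A) *)
Definition gap_set (R : realType) (V : lmodType R[i]) (ip : V -> V -> R[i])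
  (D : set V) (A B : V -> V) : set R :=
  [set r : R | forall t : R,
     ~ spectrum ip D (fun x => A x + (t%:C)%C *: B x) (r%:C)%C].

Definition discrete_set (R : realType) (P : set R) : Prop :=
  countable P /\
  forall x, P x -> exists2 e : R, 0 < e & forall y, P y -> `|y - x| < e -> y = x.

Definition dense_in_R (R : realType) (S : set R) : Prop :=
  forall (x e : R), 0 < e -> exists2 y, S y & `|y - x| < e.

(* Main.v *)
(** Write [r = Re <.,.>].  If [l] is in the gap set and [G = (A - l)^-1], then
    [1 + t B G] is boundedly invertible for all real [t], so the operator [G B],
    symmetric for the semi-inner product [<B x, y>], has no nonzero spectrum and
    [r (G B x, B x) = 0].  For [l0 <> l] close to [l] this cannot persist: the
    resolvent identity gives
    [r (G B x, B x) - r (G0 B x, B x) = (l - l0) |G0 B x|^2 + O((l - l0)^2)].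
    So gap points are isolated.

    Conversely, on [C x l2] put [A (c, u) = (<u, v>, c v + a u)] and
    [B (c, u) = (c, 0)], where [a] enumerates [P].  The Schur complement of
    [A + t B - l] is [t - l - sum_n v_n^2 / (a_n - l)]; it vanishes for some real
    [t] unless [l] is one of its poles, i.e. a point of [P], or an accumulation
    point of [P], which belongs to every spectrum since [v_n -> 0]. *)

From HB Require Import structures.
From mathcomp Require Import all_boot all_order all_algebra.
From mathcomp Require Import complex.
From mathcomp Require Import boolp classical_sets functions cardinality reals.
From mathcomp Require Import topology normedtype sequences.
From mathcomp Require Import ring lra.
Require Import Defs.
Set Implicit Arguments. Unset Strict Implicit. Unset Printing Implicit Defensive.
Import Order.TTheory GRing.Theory Num.Theory.
Import numFieldNormedType.Exports.
Local Open Scope ring_scope.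
Local Open Scope classical_set_scope.

Local Notation "s %:C" := (real_complex _ s).

(** * Isolation of the gap points *)

Lemma quad_ge0_disc (R : realFieldType) (a b c : R) : 0 <= a ->
  (forall s, 0 <= s ^+ 2 * a + 2 * s * b + c) -> b ^+ 2 <= a * c.
Proof.
move=> a0 h; have [a_gt0|] := ltP 0 a; last first.
  move=> a_le0; have -> : a = 0 by lra.
  have [->|b0] := eqVneq b 0; first by rewrite expr0n mul0r.
  (* With zero leading coefficient, this [s] would give the remaining affine function the value
     -1. *)
  have := h (- (c + 1) / (2 * b)); rewrite (_ : a = 0); last by lra.
  rewrite (_ : 2 * _ * b = - (c + 1)); last by field.
  by rewrite mulr0; lra.
have := h (- b / a).
rewrite (_ : _ + c = (a * c - b ^+ 2) / a); last by field; rewrite gt_eqF.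
by rewrite pmulr_lge0 ?invr_gt0 // subr_ge0.
Qed.

(** * Real semi-inner products *)

Section RealForms.
Variables (R : realType) (V : lmodType R[i]).

(** Degenerate forms are allowed, so that Cauchy-Schwarz applies not only to [Re <x, y>] but also to
    [<B x, y>] and to the form [q] of [form_le0]. *)
Definition real_form (q : V -> V -> R) : Prop :=
  [/\ forall s x y z, q (s%:C *: x + y) z = s * q x z + q y z,
      forall x y, q x y = q y x & forall x, 0 <= q x x].

Definition real_linear (T : V -> V) : Prop :=
  forall s x y, T (s%:C *: x + y) = s%:C *: T x + T y.

Lemma scaleN1C (x : V) : (-1)%:C *: x = - x.
Proof. by rewrite rmorphN rmorph1 scaleN1r. Qed.

Lemma real_linear0 T : real_linear T -> T 0 = 0.
Proof. by move=> lin; have := lin (-1) 0 0; rewrite scaler0 addr0 scaleN1C addNr. Qed.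

Lemma real_linearZ T s x : real_linear T -> T (s%:C *: x) = s%:C *: T x.
Proof. by move=> lin; rewrite -[X in T X]addr0 lin real_linear0// addr0. Qed.

Variable q : V -> V -> R.
Hypothesis hq : real_form q.

Lemma rform_sym x y : q x y = q y x.
Proof. by case: hq. Qed.

Lemma rform_ge0 x : 0 <= q x x.
Proof. by case: hq. Qed.

Lemma rformPl s x y z : q (s%:C *: x + y) z = s * q x z + q y z.
Proof. by case: hq. Qed.

Lemma rformPr s x y z : q z (s%:C *: x + y) = s * q z x + q z y.
Proof. by rewrite rform_sym rformPl !(rform_sym z). Qed.

Lemma rformDl x y z : q (x + y) z = q x z + q y z.
Proof. by rewrite -{1}(scale1r x) (rformPl 1) mul1r. Qed.

Lemma rformDr x y z : q z (x + y) = q z x + q z y.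
Proof. by rewrite rform_sym rformDl !(rform_sym z). Qed.

Lemma rform0l z : q 0 z = 0.
Proof. by apply: (@addrI _ (q 0 z)); rewrite -rformDl !addr0. Qed.

Lemma rformZl s x z : q (s%:C *: x) z = s * q x z.
Proof. by rewrite -{1}(addr0 (_ *: x)) rformPl rform0l addr0. Qed.

Lemma rformZr s x z : q z (s%:C *: x) = s * q z x.
Proof. by rewrite rform_sym rformZl rform_sym. Qed.

Lemma rformBl x y z : q (x - y) z = q x z - q y z.
Proof. by rewrite -scaleN1C rformDl rformZl mulN1r. Qed.

Lemma rformBr x y z : q z (x - y) = q z x - q z y.
Proof. by rewrite rform_sym rformBl !(rform_sym z). Qed.

(** The discriminant of the nonnegative polynomial [q (s x + y) (s x + y)] in [s]; its leading
    coefficient [q x x] may vanish. *)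
Lemma rform_cs x y : q x y ^+ 2 <= q x x * q y y.
Proof.
apply: quad_ge0_disc => [|s]; first exact: rform_ge0.
have := rform_ge0 (s%:C *: x + y); rewrite rformPl !rformPr (rform_sym y x).
by congr (0 <= _); ring.
Qed.

Lemma rformD_le x y : q (x + y) (x + y) <= 2 * q x x + 2 * q y y.
Proof.
have := rform_ge0 (x - y).
rewrite !rformBl !rformBr !rformDl !rformDr (rform_sym y x); lra.
Qed.

End RealForms.

(** * The form [<G B x, B x>] under lower bounds on [1 + t B G] *)

Section QuasiNilpotent.
Variables (R : realType) (V : lmodType R[i]) (r : V -> V -> R).
Hypothesis hr : real_form r.
Variables (B G : V -> V) (b g : R).
Hypothesis B_lin : real_linear B.
Hypothesis G_lin : real_linear G.
Hypothesis B_sym : forall x y, r (B x) y = r x (B y).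
Hypothesis G_sym : forall x y, r (G x) y = r x (G y).
Hypothesis B_ge0 : forall x, 0 <= r (B x) x.
Hypothesis B_bnd : forall x, r (B x) (B x) <= b * r x x.
Hypothesis G_bnd : forall x, r (G x) (G x) <= g * r x x.
Hypothesis b0 : 0 <= b.
Hypothesis g0 : 0 <= g.

(** Expand [r (T x + x) (T x + x)] and [r (T x - x) (T x - x)], both nonnegative. The constant
    [m + 1] replaces twice the square root of [m]. *)
Lemma sym_form_abs_le (T : V -> V) (m : R) x :
  r (T x) (T x) <= m * r x x -> 2 * `|r (T x) x| <= (m + 1) * r x x.
Proof.
move=> hT; have h1 := rform_ge0 hr (T x + x).
have h2 := rform_ge0 hr (T x - x).
move: h1 h2; rewrite !(rformBl hr) !(rformBr hr) !(rformDl hr) !(rformDr hr).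
rewrite (rform_sym hr x (T x)) => h1 h2.
have : `|r (T x) x| <= ((m + 1) * r x x) / 2 by rewrite ler_norml; lra.
lra.
Qed.

Lemma B_form : real_form (fun x y => r (B x) y).
Proof.
split=> [s x y z|x y|x]; last exact: B_ge0.
  by rewrite B_lin (rformPl hr).
by rewrite B_sym (rform_sym hr).
Qed.

(** Cauchy-Schwarz for [<B x, y>] at [x] and [B x] gives [|B x|^4 <= <B x, x> <B B x, B x>]; the
    last factor is at most a multiple of [|B x|^2], which cancels. *)
Lemma normB_le x : 2 * r (B x) (B x) <= (b + 1) * r (B x) x.
Proof.
have b_ge0 := b0; have cs := rform_cs B_form x (B x); have := B_ge0 x.
have := sym_form_abs_le (B_bnd (B x)); rewrite (ger0_norm (B_ge0 _)).
have := rform_ge0 hr (B x); move: cs; rewrite /=.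
set n := r (B x) (B x); set s := r (B x) x; set m := r (B (B x)) _.
move=> cs n0 mn s0; have bs : 0 <= (b + 1) * s by apply: mulr_ge0 => //; lra.
have [n_gt0|] := ltP 0 n; last by lra.
by rewrite -(ler_pM2r n_gt0); have := ler_wpM2l s0 mn; lra.
Qed.

(** For the semi-inner product [<B x, y>], [k] is the quadratic form of [G B] and [s] is the squared
    seminorm. *)
Let k x := r (G (B x)) (B x).
Let s x := r (B x) x.

Lemma k_form : forall x, 4 * `|k x| <= (g + 1) * (b + 1) * s x.
Proof.
move=> x; have := sym_form_abs_le (G_bnd (B x)); rewrite -/(k x).
have b_ge0 := b0; have g_ge0 := g0; have g1 : 0 <= g + 1 by lra.
by have := ler_wpM2l g1 (normB_le x); rewrite -/(s x); lra.
Qed.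

(** If [G] is the resolvent of [A] at [l], then [(A + t B - l) G = 1 + t B G]; a bounded inverse of
    [A + t B - l] maps [(1 + t B G) z] to [G z], whence this bound. *)
Hypothesis inv : forall t, exists c, forall z,
  r (G z) (G z) <= c * r (z + t%:C *: B (G z)) (z + t%:C *: B (G z)).

(* Any positive supremum M of k / s would be an approximate eigenvalue, for the
   semi-inner product s, of the symmetric operator G B; this contradicts
   the lower bound [inv] at t = - 1 / M. *)
Lemma form_le0 x : k x <= 0.
Proof.
have b_ge0 := b0; have g_ge0 := g0; rewrite leNgt; apply/negP => kx.
pose E := [set y | exists2 x, 0 < s x & y = k x / s x].
have s_gt0 z : 0 < k z -> 0 < s z.
  move=> kz; have := k_form z; rewrite (gtr0_norm kz) => h.
  have : 0 < (g + 1) * (b + 1) * s z by lra.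
  by rewrite pmulr_rgt0 // mulr_gt0; lra.
have Ex : E (k x / s x) by exists x => //; exact: s_gt0.
have Eub : has_ubound E.
  exists ((g + 1) * (b + 1)) => _ [z sz ->]; rewrite ler_pdivrMr//.
  have := k_form z; have := ler_norm (k z); have : 0 <= (g + 1) * (b + 1) * s z.
    by rewrite !mulr_ge0//; lra.
  by lra.
have Esup : has_sup E by split=> //; exists (k x / s x).
pose M := sup E.
have M_gt0 : 0 < M.
  by apply: lt_le_trans (ub_le_sup Eub Ex); rewrite divr_gt0// s_gt0.
have kM z : k z <= M * s z.
  have [kz|kz] := ltP 0 (k z).
    rewrite -ler_pdivrMr ?s_gt0//; apply: (ub_le_sup Eub).
    by exists z => //; exact: s_gt0.
  by apply: le_trans kz _; rewrite mulr_ge0 ?(ltW M_gt0) ?B_ge0.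
(* By maximality of [M] this form is nonnegative; it measures how far [y] is from being an
   eigenvector of [G B] for [M]. *)
pose q y z := M * r (B y) z - r (G (B y)) (B z).
have hq : real_form q.
  split=> [a y z w|y z|y]; last by rewrite subr_ge0; exact: kM.
    by rewrite /q !B_lin G_lin !(rformPl hr); ring.
  by rewrite /q B_sym (rform_sym hr y) G_sym (rform_sym hr (B y)).
pose C1 := M * (b + 1) + (g + 1) * (b + 1) * (b + 1).
have C1_ge0 : 0 <= C1.
  by rewrite addr_ge0// !mulr_ge0//; lra.
(* [w = B (M - G B)] represents [q] with respect to [r]. Cauchy-Schwarz for [q] at [y] and [w y]
   then bounds [|w y|^2] by a multiple of [q y y]. *)
pose w y := M%:C *: B y + (-1)%:C *: B (G (B y)).
have rw y z : r (w y) z = q y z.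
  by rewrite /w (rformPl hr) (rformZl hr) mulN1r (B_sym (G _)).
have qw y : q y y <= C1 * r y y.
  have h1 := k_form y; have h2 := sym_form_abs_le (B_bnd y).
  rewrite /q -/(k y) -/(s y) in h2 *.
  have h3 := ler_norm (- k y); rewrite normrN in h3.
  have h4 := rform_ge0 hr y; have h5 := ler_norm (s y).
  have h6 : M * s y <= M * ((b + 1) * r y y).
    by rewrite ler_pM2l//; have := normr_ge0 (s y); lra.
  have h7 : (g + 1) * (b + 1) * s y <= (g + 1) * (b + 1) * ((b + 1) * r y y).
    apply: ler_wpM2l; first by rewrite mulr_ge0; lra.
    have := normr_ge0 (s y); lra.
  have := normr_ge0 (k y); rewrite /C1; lra.
have w_le y : r (w y) (w y) <= C1 * q y y.
  have := rform_cs hq y (w y); rewrite -(rw y).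
  have := qw (w y); have := rform_ge0 hr (w y); have := rform_ge0 hq y.
  set n := r _ _; set a := q y y; set c := q _ _ => a0 n0 cn cs.
  have aC : 0 <= C1 * a by rewrite mulr_ge0.
  have [n_gt0|] := ltP 0 n; last by lra.
  by rewrite -(ler_pM2r n_gt0); have := ler_wpM2l a0 cn; lra.
(* At [t = - 1 / M], [(1 + t B G) B y] is exactly [w y / M], so [G B y] is controlled by [w y]. *)
have [c0 hc0] := inv (- M^-1).
pose c := `|c0|; have c_ge0 : 0 <= c by exact: normr_ge0.
have hc y : r (G (B y)) (G (B y)) <= c * (M^-1 ^+ 2 * r (w y) (w y)).
  apply: le_trans (hc0 (B y)) _.
  have -> : B y + (- M^-1)%:C *: B (G (B y)) = (M^-1)%:C *: w y.
    rewrite /w scalerDr !scalerA -!rmorphM/= mulVf ?gt_eqF// scale1r.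
    by rewrite mulrN1.
  rewrite (rformZl hr) (rformZr hr) mulrA -expr2.
  apply: ler_wpM2r; last exact: ler_norm.
  by rewrite mulr_ge0 ?sqr_ge0 ?(rform_ge0 hr).
pose C := c * M^-1 ^+ 2 * C1 * (b + 1).
have C_ge0 : 0 <= C.
  have iM : 0 <= M^-1 by rewrite invr_ge0 ltW.
  by rewrite !mulr_ge0//; lra.
have key y : k y ^+ 2 <= C * (M * s y - k y) * s y.
  apply: le_trans (rform_cs hr _ _) _.
  have h1 := hc y; have h2 := w_le y; have h3 := normB_le y.
  have h4 : r (B y) (B y) <= (b + 1) * s y.
    by have := rform_ge0 hr (B y); rewrite /s; lra.
  have -> : C * (M * s y - k y) * s y =
    (c * (M^-1 ^+ 2 * (C1 * q y y))) * ((b + 1) * s y).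
    by rewrite /C /q -/(k y) -/(s y); ring.
  apply: ler_pM; rewrite ?(rform_ge0 hr)//.
  apply: le_trans h1 _; apply: ler_wpM2l; first exact: normr_ge0.
  by apply: ler_wpM2l; rewrite ?sqr_ge0.
(* A ratio [f = k y / s y > M - d] satisfies [f > M / 2], hence [f^2 > M^2 / 4], whereas [key] gives
   [f^2 <= C d <= M^2 / 8]. Using [C + 1] keeps the denominator positive when [C = 0]. *)
pose d := Num.min (M / 2) (M ^+ 2 / (8 * (C + 1))).
have d_gt0 : 0 < d.
  rewrite /d lt_min !divr_gt0 ?exprn_gt0//=; lra.
have [_ [y sy ->]] := sup_adherent d_gt0 Esup; rewrite -/M => hy.
have d1 : d <= M / 2 by rewrite /d ge_min lexx.
have d2 : d * (8 * (C + 1)) <= M ^+ 2.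
  by rewrite -ler_pdivlMr ?ge_min ?lexx ?orbT//; lra.
have rM : k y / s y <= M by rewrite ler_pdivrMr.
have : (k y / s y) ^+ 2 <= C * (M - k y / s y).
  have sy0 : s y != 0 by rewrite gt_eqF.
  rewrite -(ler_pM2r (exprn_gt0 2 sy)); have := key y.
  by congr (_ <= _); field.
move: hy rM; set f := k y / s y => hy rM h.
have : C * (M - f) <= C * d by apply: ler_wpM2l => //; lra.
nra.
Qed.

End QuasiNilpotent.

(** Each point is the only point of [P] in some interval with rational endpoints, and it is
    determined by that pair of rationals. *)
Lemma isolated_countable (R : realType) (P : set R) :
  (forall x, P x -> exists2 e : R, 0 < e & forall y, P y -> `|y - x| < e -> y = x) ->
  countable P.
Proof.
move=> iso.
have /(_ _)/cid H x : exists ab : rat * rat, P x ->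
    ratr ab.1 < x < ratr ab.2 /\
    forall y, P y -> ratr ab.1 < y < ratr ab.2 -> y = x.
  have [Px|] := pselect (P x); last by exists (0, 0).
  have [e e0 he] := iso x Px.
  have /rat_in_itvoo[a ax] : x - e < x by lra.
  have /rat_in_itvoo[b bx] : x < x + e by lra.
  move: ax bx; rewrite !in_itv/= => /andP[a1 a2] /andP[b1 b2].
  exists (a, b) => _ /=; split=> [|y Py /andP[h1 h2]]; first by rewrite a2 b1.
  by apply: he => //; rewrite ltr_norml; lra.
apply/countable_injP; exists (fun x => pickle (sval (H x))) => x y.
rewrite !inE => Px Py /(pcan_inj pickleK) E.
have [hx _] := svalP (H x) Px; have [_ hy] := svalP (H y) Py.
by apply: hy => //; rewrite -E.
Qed.

(** * The real part of the inner product *)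

Section InnerProduct.
Variables (R : realType) (V : lmodType R[i]) (ip : V -> V -> R[i]).

Definition re_ip (x y : V) : R := complex.Re (ip x y).

Lemma ReD (x y : R[i]) : complex.Re (x + y) = complex.Re x + complex.Re y.
Proof. by case: x y => [? ?] [? ?]. Qed.

Lemma ReMl (s : R) (x : R[i]) : complex.Re (s%:C * x) = s * complex.Re x.
Proof. by case: x => ? ? /=; rewrite mul0r subr0. Qed.

Lemma Re_conj (x : R[i]) : complex.Re (Num.conj x) = complex.Re x.
Proof. by case: x. Qed.

Hypothesis ipP : forall (a : R[i]) (x y z : V),
  ip (a *: x + y) z = a * ip x z + ip y z.
Hypothesis ipC : forall x y : V, ip y x = Num.conj (ip x y).
Hypothesis ip0 : forall x : V, 0 <= ip x x.

Lemma re_ip_form : real_form re_ip.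
Proof.
split=> [s x y z|x y|x].
- by rewrite /re_ip ipP ReD ReMl.
- by rewrite /re_ip ipC Re_conj.
- by have := ip0 x; rewrite lecE => /andP[].
Qed.

Lemma nsqE x : nsq ip x = (re_ip x x)%:C.
Proof.
rewrite /nsq /re_ip; case: (ip x x) (ip0 x) => a b.
by rewrite lecE /= => /andP[/eqP-> _].
Qed.

(** The constant in [bounded_op] is complex; squared norms being real, its real part already gives
    the bound, and the absolute value makes it nonnegative. *)
Lemma bounded_op_re (T : V -> V) : bounded_op ip T ->
  exists2 M : R, 0 <= M & forall x, re_ip (T x) (T x) <= M * re_ip x x.
Proof.
case=> _ [M hM]; exists `|complex.Re M| => // x.
have := hM x; rewrite !nsqE mulrC lecE ReMl /= => /andP[_] /le_trans; apply.
by rewrite mulrC ler_wpM2r ?ler_norm ?(rform_ge0 re_ip_form).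
Qed.

Lemma bounded_op_real_linear (T : V -> V) : bounded_op ip T -> real_linear T.
Proof. by case=> hT _ s x y; exact: hT. Qed.

End InnerProduct.

(** * Isolated gap points and density of the spectra *)

Section Gap.
Variables (R : realType) (V : lmodType R[i]) (ip : V -> V -> R[i]).
Hypothesis H : is_hilbert ip.
Variables (D : set V) (A B : V -> V).
Hypothesis A_sa : self_adjoint ip D A.
Hypothesis B_sa : self_adjoint ip setT B.
Hypothesis B_bd : bounded_op ip B.
Hypothesis B_nn : nonneg_op ip B.

Local Notation r := (re_ip ip).

Let hr : real_form r.
Proof. by case: H => h1 h2 h3 _ _; exact: re_ip_form. Qed.

Let r_eq0 x : r x x = 0 -> x = 0.
Proof.
case: H => h1 h2 h3 h4 _ rx; apply: h4.
by rewrite -[ip x x]/(nsq ip x) nsqE// rx.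
Qed.

Let bdE (T : V -> V) : bounded_op ip T ->
  exists2 M : R, 0 <= M & forall x, r (T x) (T x) <= M * r x x.
Proof. by case: H => h1 h2 h3 _ _; exact: bounded_op_re. Qed.

(** Linearity and boundedness are kept in real form, since the perturbation argument takes place in
    [Re <x, y>]. *)
Definition is_resolvent (l : R) (G : V -> V) : Prop :=
  [/\ real_linear G,
      exists2 g : R, 0 <= g & forall x, r (G x) (G x) <= g * r x x,
      forall z, D (G z) /\ A (G z) - l%:C *: G z = z &
      forall x, D x -> G (A x - l%:C *: x) = x].

(** Write [x = (A - l) G x] and [y = (A - l) G y], and use that [A] is symmetric and [l] real. *)
Lemma resolvent_sym (l : R) (G : V -> V) x y : is_resolvent l G ->
  r (G x) y = r x (G y).
Proof.
move=> [_ _ h _]; have [Dx Ex] := h x; have [Dy Ey] := h y.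
have [_ _ _ /(_ _ _ Dx Dy) symA] := A_sa.
have symr : r (A (G x)) (G y) = r (G x) (A (G y)) by rewrite /re_ip symA.
rewrite -{1}Ey -{2}Ex (rformBr hr) (rformBl hr) (rformZl hr) (rformZr hr).
by rewrite symr.
Qed.

Lemma gap_resolvent (l : R) : gap_set ip D A B l ->
  exists2 G, is_resolvent l G & forall x, r (G (B x)) (B x) = 0.
Proof.
move=> gap.
have res t : in_resolvent ip D (fun x => A x + t%:C *: B x) l%:C.
  by apply: contrapT => h; exact: (gap t h).
have [G [Gbd G1 G2]] := res 0.
have hG : is_resolvent l G.
  split; first exact: bounded_op_real_linear Gbd.
  - exact: bdE.
  - by move=> z; have [] := G1 z; rewrite scale0r addr0.
  - by move=> x Dx; have := G2 x Dx; rewrite scale0r addr0.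
exists G => // x.
have [Glin [g g0 Gg] GD _] := hG.
have [b b0 Bb] := bdE B_bd.
have Blin := bounded_op_real_linear B_bd.
have Bsym y z : r (B y) z = r y (B z).
  by case: B_sa => _ _ _ s; rewrite /re_ip s.
have Bge0 y : 0 <= r (B y) y by have := B_nn y; rewrite lecE => /andP[].
have Ginv t : exists c, forall z,
    r (G z) (G z) <= c * r (z + t%:C *: B (G z)) (z + t%:C *: B (G z)).
  (* [S] inverts [A + t B - l], so it sends [z + t B G z = (A + t B - l) G z] to [G z]. *)
  have [S [Sbd _ S2]] := res t; have [c _ hc] := bdE Sbd.
  exists c => z; have [Dz Ez] := GD z.
  have := hc (z + t%:C *: B (G z)); congr (r _ _ <= _).
    by rewrite -[in RHS](S2 _ Dz) -{1}Ez addrAC.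
  by rewrite -[in RHS](S2 _ Dz) -{1}Ez addrAC.
have GN1 z : r ((-1)%:C *: G z) ((-1)%:C *: G z) = r (G z) (G z).
  by rewrite (rformZl hr) (rformZr hr) !mulN1r opprK.
apply/eqP; rewrite eq_le; apply/andP; split.
  apply: (form_le0 hr Blin Glin Bsym _ Bge0 Bb Gg) => // y z.
  exact: resolvent_sym hG.
(* The other inequality is [form_le0] for [- G], whose lower bound at [t] is that of [G] at
   [- t]. *)
rewrite -oppr_le0 -mulN1r -(rformZl hr).
apply: (form_le0 hr (G := fun z => (-1)%:C *: G z) Blin _ Bsym _ Bge0 Bb (g := g)) => //.
- by move=> s y z; rewrite Glin scalerDr !scalerA mulrC.
- by move=> y z; rewrite (rformZl hr) (rformZr hr) (resolvent_sym _ _ hG).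
- by move=> z; rewrite GN1.
move=> t; have [c hc] := Ginv (- t); exists c => z.
rewrite GN1 (real_linearZ _ _ Blin) scalerA; have := hc z.
by rewrite -rmorphM/= mulrN1.
Qed.

(** With [y = B x], [u = G0 y], [h = G u] and [m = l - l0], the vanishing of both forms at [y]
    forces [|u|^2 = - m <h, u>], which is too small when [m] is small, because [u] is nonzero. *)
Lemma gap_isolated (l0 : R) : (exists x, B x != 0) -> gap_set ip D A B l0 ->
  exists2 e : R, 0 < e &
    forall l, gap_set ip D A B l -> `|l - l0| < e -> l = l0.
Proof.
move=> [x Bx0] /gap_resolvent[G0 hG0 k0].
have [G0lin [g g0 G0g] G0D G0l] := hG0.
(* This radius depends only on the bound of [G0]; it gives [|m| <= 1] and [4 g |m| < 1], hence
   [4 g m^2 < 1]. *)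
exists (1 + 4 * g)^-1; first by rewrite invr_gt0; lra.
move=> l /gap_resolvent[G hG k] le; apply/eqP; rewrite -subr_eq0; apply/negPn/negP.
move: le; set m := l - l0 => le m0.
have [Glin _ GD Gl] := hG.
pose y := B x; pose u := G0 y; pose h := G u.
have [Du Eu] := G0D y; rewrite -/u in Du Eu.
have [Dh Eh] := GD u; rewrite -/h in Dh Eh.
have lE : l = l0 + m by rewrite /m addrC subrK.
clearbody m.
have shift a z : a - l0%:C *: z = m%:C *: z + (a - l%:C *: z).
  rewrite lE rmorphD/= scalerDl opprD addrCA; congr (_ + _).
  by rewrite addrCA subrr addr0.
(* The resolvent identity, applied to [y] here and rearranged below so as to bound [h] through [G0]
   alone. *)
have Gy : G y = m%:C *: h + u by rewrite -[y]Eu shift Glin Gl.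
have hE : h = G0 (m%:C *: h + u) by rewrite -[in RHS]Eh -shift G0l.
have u0 : r u u != 0.
  apply/eqP => /r_eq0 uE; move: Bx0; rewrite -/y -Eu uE scaler0 subr0.
  have [[[D0 _] Alin] _ _ _] := A_sa.
  by have := Alin (-1) _ _ D0 D0; rewrite scaler0 addr0 scaleN1r addNr => ->; rewrite eqxx.
(* Since [<G y, y>] and [<u, y>] vanish, so does [m <h, y>]; divide by [m] and move [G] across:
   [<h, y> = <u, G y>]. *)
have eq0 : r u u + m * r h u = 0.
  have : r (G y) y = 0 by exact: k.
  rewrite {1}Gy (rformPl hr) [r u y]k0 addr0 /h (resolvent_sym _ _ hG) Gy (rformPr hr) -/h.
  by move/eqP; rewrite mulf_eq0 (negbTE m0)/= => /eqP; rewrite (rform_sym hr h) => <-; rewrite addrC.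
have cs := rform_cs hr h u.
have u_gt0 : 0 < r u u by rewrite lt_def u0 (rform_ge0 hr).
have hle : r h h <= g * (2 * (m ^+ 2 * r h h) + 2 * r u u).
  rewrite {1 2}hE; apply: le_trans (G0g _) _; apply: ler_wpM2l => //.
  apply: le_trans (rformD_le hr _ _) _.
  by rewrite (rformZl hr) (rformZr hr) mulrA -expr2.
have mg : 4 * g * m ^+ 2 < 1.
  move: le; rewrite -[X in _ < X]mul1r ltr_pdivlMr; last by lra.
  rewrite -(real_normK (num_real m)); have := normr_ge0 m.
  set a := `|m| => a0 am; have ga : 0 <= g * a by exact: mulr_ge0.
  have a1 : a <= 1 by lra.
  by have := ler_wpM2l ga a1; lra.
have hle2 : r h h <= 4 * g * r u u.
  have := rform_ge0 hr h; nra.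
have : (m * r h u) ^+ 2 = r u u ^+ 2.
  by rewrite -[m * _](addKr (r u u)) eq0 addr0 sqrrN.
rewrite exprMn => E.
have : r u u ^+ 2 <= m ^+ 2 * (4 * g * r u u * r u u).
  rewrite -E; apply: ler_wpM2l; first exact: sqr_ge0.
  by apply: le_trans cs _; apply: ler_wpM2r => //; exact: ltW.
have : 0 < r u u ^+ 2 * (1 - 4 * g * m ^+ 2).
  by rewrite mulr_gt0 ?exprn_gt0// subr_gt0.
lra.
Qed.

Lemma gap_discrete : (exists x, B x != 0) -> discrete_set (gap_set ip D A B).
Proof.
move=> Bnz; have iso := gap_isolated Bnz.
by split=> //; apply: isolated_countable => x; exact: iso.
Qed.

(** An interval missing the union would consist of gap points, against the isolation of its
    centre. *)
Lemma union_spectra_dense : (exists x, B x != 0) ->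
  dense_in_R [set l : R | exists t : R,
    spectrum ip D (fun x => A x + t%:C *: B x) l%:C].
Proof.
move=> Bnz x e e0; apply: contrapT => h.
have gap y : `|y - x| < e -> gap_set ip D A B y.
  by move=> yx t ty; apply: h; exists y => //; exists t.
have [d d0 hd] : exists2 d : R, 0 < d &
    forall l, gap_set ip D A B l -> `|l - x| < d -> l = x.
  by apply: gap_isolated => //; apply: gap; rewrite subrr normr0.
pose f := Num.min d e / 2.
have f0 : 0 < f by rewrite divr_gt0// lt_min d0.
have fd : f < d.
  have : Num.min d e <= d by rewrite ge_min lexx.
  rewrite /f in f0 *; lra.
have fe : f < e.
  have : Num.min d e <= e by rewrite ge_min lexx orbT.
  rewrite /f in f0 *; lra.
have := hd (x + f); rewrite [x + f]addrC addrK gtr0_norm// => /(_ _ fd) E.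
have : f + x = x by apply: E; apply: gap; rewrite addrK gtr0_norm.
lra.
Qed.

End Gap.

(** * The Hilbert spaces [l2] and [C x l2] *)

Section ComplexSums.
Variable R : realType.
Implicit Types (f g : nat -> R[i]) (x y : nat -> R[i]) (z : R[i]) (u : nat -> R).

Definition abs2 (z : R[i]) : R := complex.Re z ^+ 2 + complex.Im z ^+ 2.

Lemma abs2_ge0 z : 0 <= abs2 z.
Proof. by rewrite addr_ge0 ?sqr_ge0. Qed.

Lemma abs2E z : z * Num.conj z = (abs2 z)%:C.
Proof.
case: z => a b; apply/eqP; rewrite eq_complex /abs2/=.
by apply/andP; split; apply/eqP; ring.
Qed.

Lemma abs2M z w : abs2 (z * w) = abs2 z * abs2 w.
Proof. by case: z w => a b [c d]; rewrite /abs2/=; ring. Qed.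

Lemma abs2_real (s : R) : abs2 s%:C = s ^+ 2.
Proof. by rewrite /abs2/= expr0n addr0. Qed.

Lemma abs2_0 : abs2 0 = 0.
Proof. by rewrite (abs2_real 0) expr0n. Qed.

Lemma abs2_eq0 z : abs2 z = 0 -> z = 0.
Proof.
case: z => a b /eqP; rewrite /abs2/= paddr_eq0 ?sqr_ge0// !sqrf_eq0.
by move=> /andP[/eqP-> /eqP->].
Qed.

Lemma abs2D_le z w : abs2 (z + w) <= 2 * abs2 z + 2 * abs2 w.
Proof.
case: z w => a b [c d]; rewrite /abs2/=.
have := sqr_ge0 (a - c); have := sqr_ge0 (b - d); nra.
Qed.

Lemma abs2_conjM_Re z w : `|complex.Re (z * Num.conj w)| <= abs2 z + abs2 w.
Proof.
case: z w => a b [c d]; rewrite /abs2/= ler_norml.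
have := sqr_ge0 (a - c); have := sqr_ge0 (b - d).
have := sqr_ge0 (a + c); have := sqr_ge0 (b + d); nra.
Qed.

Lemma abs2_conjM_Im z w : `|complex.Im (z * Num.conj w)| <= abs2 z + abs2 w.
Proof.
case: z w => a b [c d]; rewrite /abs2/= ler_norml.
have := sqr_ge0 (a - d); have := sqr_ge0 (b - c).
have := sqr_ge0 (a + d); have := sqr_ge0 (b + c); nra.
Qed.

Lemma series_lin u (w : nat -> R) (s l m : R) :
  series u @ \oo --> l -> series w @ \oo --> m ->
  series (fun n => s * u n + w n) @ \oo --> s * l + m.
Proof.
move=> ul wm.
have -> : series (fun n => s * u n + w n) = (fun N => s * series u N + series w N).
  by apply/funext => N; rewrite /series/= big_split/= mulr_sumr.
by apply: cvgD => //; apply: cvgM => //; exact: cvg_cst.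
Qed.

Definition has_csum f (l : R[i]) : Prop :=
  series (fun n => complex.Re (f n)) @ \oo --> complex.Re l /\
  series (fun n => complex.Im (f n)) @ \oo --> complex.Im l.

Definition csum f : R[i] :=
  Complex (limn (series (fun n => complex.Re (f n))))
          (limn (series (fun n => complex.Im (f n)))).

Definition csummable f : Prop := exists l, has_csum f l.

Lemma has_csum_eq f l : has_csum f l -> csum f = l.
Proof. by case: l => a b [/= h1 h2]; rewrite /csum; congr Complex; exact: cvg_lim. Qed.

Lemma csummableP f : csummable f -> has_csum f (csum f).
Proof. by move=> [l h]; rewrite (has_csum_eq h). Qed.

Lemma has_csum_lin f g (a l m : R[i]) : has_csum f l -> has_csum g m ->
  has_csum (fun n => a * f n + g n) (a * l + m).
Proof.
case: a l m => a b [l1 l2] [m1 m2] [/= f1 f2] [/= g1 g2]; split.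
  have := series_lin (s := a) f1 (series_lin (s := - b) f2 g1).
  have -> : (fun n => a * complex.Re (f n) + (- b * complex.Im (f n) + complex.Re (g n))) =
    (fun n => complex.Re ((Complex a b) * f n + g n)).
    by apply/funext => n; case: (f n) (g n) => ? ? [? ?] /=; ring.
  by rewrite (_ : a * l1 + _ = complex.Re (Complex a b * Complex l1 l2 + Complex m1 m2))//=; ring.
have := series_lin (s := a) f2 (series_lin (s := b) f1 g2).
have -> : (fun n => a * complex.Im (f n) + (b * complex.Re (f n) + complex.Im (g n))) =
  (fun n => complex.Im ((Complex a b) * f n + g n)).
  by apply/funext => n; case: (f n) (g n) => ? ? [? ?] /=; ring.
by rewrite (_ : a * l2 + _ = complex.Im (Complex a b * Complex l1 l2 + Complex m1 m2))//=; ring.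
Qed.

Lemma has_csum_conj f l : has_csum f l ->
  has_csum (fun n => Num.conj (f n)) (Num.conj l).
Proof.
case: l => a b [/= h1 h2]; split => /=.
  have -> : (fun n => complex.Re (Num.conj (f n))) = (fun n => complex.Re (f n)).
    by apply/funext => n; case: (f n).
  exact: h1.
have -> : (fun n => complex.Im (Num.conj (f n))) = (fun n => - complex.Im (f n)).
  by apply/funext => n; case: (f n).
have -> : series (fun n => - complex.Im (f n)) = - series (fun n => complex.Im (f n)).
  by apply/funext => N; rewrite /series/= sumrN.
exact: cvgN.
Qed.

Lemma series_single (u : nat -> R) m : (forall n, n != m -> u n = 0) ->
  series u @ \oo --> u m.
Proof.
move=> h; apply: cvg_near_cst; exists m.+1 => //= N /= mN.
rewrite /series/= big_mkord (bigD1 (Ordinal mN))//= big1 ?addr0// => i im.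
by apply: h; apply: contra im => /eqP im; apply/eqP/val_inj.
Qed.

Lemma has_csum_single f m : (forall n, n != m -> f n = 0) -> has_csum f (f m).
Proof.
move=> h; split.
  by apply: (@series_single (fun n => complex.Re (f n))) => n /h ->.
by apply: (@series_single (fun n => complex.Im (f n))) => n /h ->.
Qed.

Lemma csummable_norm f (u : nat -> R) : cvgn (series u) ->
  (forall n, `|complex.Re (f n)| <= u n) -> (forall n, `|complex.Im (f n)| <= u n) ->
  csummable f.
Proof.
move=> cu h1 h2.
have key (w : nat -> R) : (forall n, `|w n| <= u n) -> cvgn (series w).
  move=> hw; apply: normed_cvg; apply: series_le_cvg cu => n //=.
  exact: le_trans (hw n).
by exists (csum f); split; exact: key.
Qed.

(* Bounded partial sums, rather than convergence, make the passage to the limit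
   in the completeness proof immediate. *)
Definition sqsum : {pred (nat -> R[i])} := fun x =>
  `[< exists M : R, forall n, \sum_(i < n) abs2 (x i) <= M >].

Lemma sqsumP x : reflect (exists M : R, forall n, \sum_(i < n) abs2 (x i) <= M)
  (x \in sqsum).
Proof. exact: asboolP. Qed.

Lemma seriesEord u N : series u N = \sum_(i < N) u i.
Proof. by rewrite /series/= big_mkord. Qed.

Lemma series_abs2_nd x :
  {homo series (fun n => abs2 (x n)) : n m / (n <= m)%N >-> (n <= m)%R}.
Proof. by apply: nondecreasing_series => n _ _; exact: abs2_ge0. Qed.

Lemma sum_abs2_nd x n m : (n <= m)%N ->
  \sum_(i < n) abs2 (x i) <= \sum_(i < m) abs2 (x i).
Proof. by move=> nm; have := series_abs2_nd x nm; rewrite !seriesEord. Qed.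

Lemma sqsum_cvg x : x \in sqsum -> cvgn (series (fun n => abs2 (x n))).
Proof.
move=> /sqsumP[M hM]; apply: nondecreasing_is_cvgn; first exact: series_abs2_nd.
by exists M => _ [n _ <-]; rewrite seriesEord.
Qed.

Lemma sqsum_ge x n : x \in sqsum ->
  \sum_(i < n) abs2 (x i) <= limn (series (fun n => abs2 (x n))).
Proof.
move=> /sqsum_cvg cx; rewrite -(seriesEord (fun n => abs2 (x n))).
exact: nondecreasing_cvgn_le (series_abs2_nd x) cx n.
Qed.

Lemma sqsum_le x (M : R) : (forall n, \sum_(i < n) abs2 (x i) <= M) ->
  limn (series (fun n => abs2 (x n))) <= M.
Proof.
move=> hM; apply: limr_le; first by apply: sqsum_cvg; apply/sqsumP; exists M.
by apply: nearW => n; rewrite seriesEord.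
Qed.

(** Domination is asked only from [N] on, so [M = 0] covers finitely supported sequences. The proof
    extends a partial sum to length [N + n] and splits it at [N]. *)
Lemma sqsum_dom N (M : R) x y : x \in sqsum -> 0 <= M ->
  (forall n, (N <= n)%N -> abs2 (y n) <= M * abs2 (x n)) -> y \in sqsum.
Proof.
move=> /sqsumP[K hK] M0 h; apply/sqsumP.
exists (\sum_(i < N) abs2 (y i) + M * K) => n.
apply: le_trans (_ : \sum_(i < N + n) abs2 (y i) <= _).
  exact: sum_abs2_nd (leq_addl _ _).
rewrite big_split_ord/= lerD2l.
apply: le_trans (_ : M * \sum_(i < N + n) abs2 (x i) <= _); last exact: ler_wpM2l.
rewrite big_split_ord/= mulrDr mulr_sumr.
apply: le_trans (_ : M * \sum_(i < n) abs2 (x (N + i)%N) <= _).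
  by rewrite mulr_sumr; apply: ler_sum => i _; rewrite h ?leq_addr.
by rewrite lerDr sumr_ge0// => i _; rewrite mulr_ge0 ?abs2_ge0.
Qed.

Lemma sqsumP_lin (a : R[i]) x y : x \in sqsum -> y \in sqsum ->
  (fun n => a * x n + y n) \in sqsum.
Proof.
move=> /sqsumP[K hK] /sqsumP[L hL]; apply/sqsumP.
exists (2 * (abs2 a * K) + 2 * L) => n.
apply: le_trans (_ : \sum_(i < n) (2 * (abs2 a * abs2 (x i)) + 2 * abs2 (y i)) <= _).
  by apply: ler_sum => i _; rewrite -abs2M abs2D_le.
rewrite big_split/= -!mulr_sumr; apply: lerD; apply: ler_wpM2l => //; last exact: hL.
by apply: ler_wpM2l; [exact: abs2_ge0 | exact: hK].
Qed.

Lemma sqsum_submod_closed : submod_closed sqsum.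
Proof.
split.
  by apply/sqsumP; exists 0 => n; rewrite big1// => i _; exact: abs2_0.
by move=> a x y hx hy; exact: sqsumP_lin.
Qed.

HB.instance Definition _ := GRing.isSubmodClosed.Build R[i] (nat -> R[i]) sqsum
  sqsum_submod_closed.

Lemma sqsum_csummable x y : x \in sqsum -> y \in sqsum ->
  csummable (fun n => x n * Num.conj (y n)).
Proof.
move=> hx hy.
apply: (@csummable_norm _ (fun n => abs2 (x n) + abs2 (y n))).
- have := is_cvg_seriesD (sqsum_cvg hx) (sqsum_cvg hy); exact.
- by move=> n; exact: abs2_conjM_Re.
- by move=> n; exact: abs2_conjM_Im.
Qed.

Lemma real_complete u :
  (forall e, 0 < e -> exists N, forall m n, (N <= m)%N -> (N <= n)%N -> `|u m - u n| < e) ->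
  cvgn u.
Proof.
move=> h; apply/cauchy_cvgP/cauchy_exP => e e0; have [N hN] := h e e0.
exists (u N); exists N => //= n /= Nn; exact: hN.
Qed.

Lemma complex_complete f :
  (forall e, 0 < e -> exists N, forall m n, (N <= m)%N -> (N <= n)%N -> abs2 (f m - f n) < e) ->
  exists l, forall e, 0 < e -> exists N, forall n, (N <= n)%N -> abs2 (f n - l) < e.
Proof.
move=> h.
have key (p : R[i] -> R) : (forall z w, p (z - w) = p z - p w) ->
    (forall z, p z ^+ 2 <= abs2 z) -> cvgn (fun n => p (f n)).
  move=> pB p2; apply: real_complete => e e0.
  have [N hN] := h _ (exprn_gt0 2 e0); exists N => m n Nm Nn.
  rewrite -pB -(ltr_pXn2r (n := 2)) ?nnegrE// ?(ltW e0)//.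
  by rewrite real_normK ?num_real//; apply: le_lt_trans (hN _ _ Nm Nn).
have c1 : cvgn (fun n => complex.Re (f n)).
  apply: key => [[? ?] [? ?]//|z]; by rewrite lerDl sqr_ge0.
have c2 : cvgn (fun n => complex.Im (f n)).
  apply: key => [[? ?] [? ?]//|z]; by rewrite lerDr sqr_ge0.
exists (Complex (limn (fun n => complex.Re (f n))) (limn (fun n => complex.Im (f n)))).
(* Real and imaginary errors below [d] give a squared modulus below [2 * (e / 4)]. *)
move=> e e0; pose d := Num.sqrt (e / 4).
have d0 : 0 < d by rewrite sqrtr_gt0 divr_gt0.
have dd : d ^+ 2 = e / 4 by rewrite sqr_sqrtr// divr_ge0// ltW.
have /cvgrPdistC_lt/(_ _ d0)[N1 _ h1] := c1.
have /cvgrPdistC_lt/(_ _ d0)[N2 _ h2] := c2.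
exists (maxn N1 N2) => n; rewrite geq_max => /andP[/h1/= g1 /h2/= g2].
move: g1 g2; rewrite -(ltr_pXn2r (n := 2)) ?nnegrE// ?(ltW d0)// => g1.
rewrite -(ltr_pXn2r (n := 2)) ?nnegrE// ?(ltW d0)//.
move: g1; rewrite !real_normK ?num_real// dd /abs2.
by case: (f n) => ? ? /=; lra.
Qed.

End ComplexSums.

(** * The Hilbert space of square-summable sequences *)

Section SquareSummable.
Variable R : realType.

Record l2 := L2 { l2_fun :> nat -> R[i]; _ : l2_fun \in @sqsum R }.

HB.instance Definition _ := [isSub for l2_fun].
HB.instance Definition _ := [Choice of l2 by <:].
HB.instance Definition _ := [SubChoice_isSubLmodule of l2 by <:].

Implicit Types x y z : l2.

Lemma l2_sq x : (x : nat -> R[i]) \in @sqsum R.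
Proof. exact: valP. Qed.

Lemma l2P x y : (forall n, x n = y n) -> x = y.
Proof. by move=> h; apply/val_inj/funext. Qed.

Lemma l2_lin (a : R[i]) x y n : (a *: x + y) n = a * x n + y n.
Proof. by []. Qed.

Lemma l2_0 n : (0 : l2) n = 0.
Proof. by []. Qed.

Lemma l2_B x y n : (x - y) n = x n - y n.
Proof. by []. Qed.

(* Junk value [0] when [f] is not square-summable. *)
Definition mkl2 (f : nat -> R[i]) : l2 := insubd (0 : l2) f.

Lemma mkl2E f n : f \in @sqsum R -> mkl2 f n = f n.
Proof. by move=> h; rewrite -[LHS]/(val (mkl2 f) n) insubdK. Qed.

Definition ip2 x y : R[i] := csum (fun n => x n * Num.conj (y n)).

Lemma ip2_has_csum x y : has_csum (fun n => x n * Num.conj (y n)) (ip2 x y).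
Proof. by apply/csummableP/sqsum_csummable; exact: l2_sq. Qed.

Lemma ip2P (a : R[i]) x y z : ip2 (a *: x + y) z = a * ip2 x z + ip2 y z.
Proof.
apply: has_csum_eq; have := has_csum_lin a (ip2_has_csum x z) (ip2_has_csum y z).
congr has_csum; apply/funext => n; rewrite l2_lin; ring.
Qed.

Lemma ip2C x y : ip2 y x = Num.conj (ip2 x y).
Proof.
apply: has_csum_eq; have := has_csum_conj (ip2_has_csum x y).
congr has_csum; apply/funext => n; rewrite rmorphM/= conjCK mulrC//.
Qed.

Definition nrm2 x : R := limn (series (fun n => abs2 (x n))).

Lemma ip2xx x : ip2 x x = (nrm2 x)%:C.
Proof.
rewrite /ip2 /csum /nrm2; under [in X in Complex _ X]eq_fun do rewrite abs2E.
under eq_fun do rewrite abs2E; congr Complex => /=.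
rewrite (_ : series _ = fun=> 0) ?lim_cst//.
by apply/funext => n; rewrite /series/= big1.
Qed.

Lemma nrm2_ge x n : \sum_(i < n) abs2 (x i) <= nrm2 x.
Proof. by apply: sqsum_ge; exact: l2_sq. Qed.

Lemma nrm2_le x (M : R) : (forall n, \sum_(i < n) abs2 (x i) <= M) -> nrm2 x <= M.
Proof. exact: sqsum_le. Qed.

Lemma nrm2_ge0 x : 0 <= nrm2 x.
Proof. by have := nrm2_ge x 0; rewrite big_ord0. Qed.

Lemma abs2_le_nrm2 x n : abs2 (x n) <= nrm2 x.
Proof.
apply: le_trans (nrm2_ge x n.+1); rewrite big_ord_recr/= lerDr.
by rewrite sumr_ge0// => i _; exact: abs2_ge0.
Qed.

Lemma nrm2_dom (M : R) x y : 0 <= M ->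
  (forall n, abs2 (y n) <= M * abs2 (x n)) -> nrm2 y <= M * nrm2 x.
Proof.
move=> M0 h; apply: nrm2_le => n.
apply: le_trans (_ : M * \sum_(i < n) abs2 (x i) <= _).
  by rewrite mulr_sumr; apply: ler_sum => i _; exact: h.
by apply: ler_wpM2l => //; exact: nrm2_ge.
Qed.

(** Coordinates converge by completeness of the complex numbers. The first [K] terms of
    [|u n - l|^2] are bounded uniformly in [K] by passing through some [u m] with [m] depending on
    [K]. *)
Lemma l2_complete (u : nat -> l2) :
  (forall e : R, 0 < e -> exists N, forall m n, (N <= m)%N -> (N <= n)%N ->
     nrm2 (u m - u n) < e) ->
  exists l : l2, forall e : R, 0 < e -> exists N, forall n, (N <= n)%N ->
     nrm2 (u n - l) < e.
Proof.
move=> h.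
have /choice[l hl] i : exists l, forall e, 0 < e ->
    exists N, forall n, (N <= n)%N -> abs2 (u n i - l) < e.
  apply: complex_complete => e e0; have [N hN] := h e e0.
  exists N => m n Nm Nn; apply: le_lt_trans (hN _ _ Nm Nn).
  by rewrite -l2_B abs2_le_nrm2.
have key e N K n : 0 < e -> (forall m n, (N <= m)%N -> (N <= n)%N ->
    nrm2 (u m - u n) < e) -> (N <= n)%N ->
    \sum_(i < K) abs2 (u n i - l i) <= 4 * e.
  move=> e0 hN Nn.
  have d0 : 0 < e / (K.+1)%:R by rewrite divr_gt0.
  have /choice[F hF] i := hl i _ d0.
  (* At [m] each of the first [K] coordinates is within [e / (K + 1)] of its limit in squared
     modulus, so these errors add up to at most [e]. *)
  pose m := (N + \sum_(i < K) F i)%N.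
  have mF (i : 'I_K) : (F i <= m)%N.
    by rewrite /m (bigD1 i)//= addnCA leq_addr.
  apply: le_trans (_ : \sum_(i < K) (2 * abs2 ((u n - u m) i) + 2 * (e / (K.+1)%:R)) <= _).
    apply: ler_sum => i _.
    have -> : u n i - l i = (u n - u m) i + (u m i - l i) by rewrite l2_B addrA subrK.
    apply: le_trans (abs2D_le _ _) _; rewrite lerD2l ler_wpM2l// ltW//.
    exact: hF.
  rewrite big_split/= -mulr_sumr sumr_const card_ord.
  have h1 : \sum_(i < K) abs2 ((u n - u m) i) < e.
    by apply: le_lt_trans (nrm2_ge _ _) _; apply: hN => //; rewrite /m leq_addr.
  have h2 : 2 * (e / K.+1%:R) *+ K <= 2 * e.
    rewrite -mulr_natr -!mulrA ler_wpM2l// ger_pMr// mulrC ler_pdivrMr// mul1r.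
    by rewrite ler_nat.
  rewrite (_ : 4 * e = 2 * e + 2 * e); last by ring.
  by apply: lerD h2; rewrite ler_pM2l// ltW.
have lsq : l \in @sqsum R.
  have [N hN] := h 1 ltr01.
  have dsq : (fun i => u N i - l i) \in @sqsum R.
    by apply/sqsumP; exists (4 * 1) => K; exact: key _ _ _ _ ltr01 hN (leqnn N).
  suff -> : l = (fun i => -1 * (u N i - l i) + u N i).
    exact: sqsumP_lin dsq (l2_sq (u N)).
  by apply/funext => i; ring.
exists (mkl2 l) => e e0.
have e8 : 0 < e / 8 by rewrite divr_gt0.
have [N hN] := h _ e8; exists N => n Nn.
apply: le_lt_trans (_ : 4 * (e / 8) < e); last by lra.
apply: nrm2_le => K; under eq_bigr do rewrite l2_B (mkl2E _ lsq).
exact: key _ _ _ _ e8 hN Nn.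
Qed.

Lemma l2_hilbert : is_hilbert ip2.
Proof.
split; first exact: ip2P.
- exact: ip2C.
- by move=> x; rewrite ip2xx ler0c nrm2_ge0.
- move=> x; rewrite ip2xx => -[x0]; apply: l2P => n; apply: abs2_eq0.
  by apply/eqP; rewrite eq_le abs2_ge0 andbT -x0 abs2_le_nrm2.
- move=> u h.
  have [|l hl] := @l2_complete u.
    move=> e e0; have [|N hN] := h e%:C; first by rewrite ltcR.
    by exists N => m n Nm Nn; have := hN m n Nm Nn; rewrite /nsq ip2xx ltcR.
  exists l => e; rewrite ltcE/= => /andP[/eqP Ie /hl[N hN]].
  by exists N => n /hN hn; rewrite /nsq ip2xx ltcE/= Ie eqxx.
Qed.

Definition delta2 (m : nat) : l2 := mkl2 (fun n => (n == m)%:R).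

Lemma delta2E m n : delta2 m n = (n == m)%:R.
Proof.
apply: mkl2E; apply: (@sqsum_dom _ m.+1 0 (0 : l2)) => //; first exact: l2_sq.
by move=> k mk; rewrite mul0r gtn_eqF// abs2_0.
Qed.

Lemma ip2_deltar x m : ip2 x (delta2 m) = x m.
Proof.
apply: has_csum_eq.
have := @has_csum_single _ (fun n => x n * Num.conj (delta2 m n)) m.
rewrite delta2E eqxx rmorph1 mulr1; apply => n nm.
by rewrite delta2E (negbTE nm) rmorph0 mulr0.
Qed.

Lemma nrm2_delta m : nrm2 (delta2 m) = 1.
Proof. by have := ip2xx (delta2 m); rewrite ip2_deltar delta2E eqxx => -[]. Qed.

Definition trunc2 N x : l2 := mkl2 (fun n => if (n < N)%N then x n else 0).

Lemma trunc2E N x n : trunc2 N x n = if (n < N)%N then x n else 0.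
Proof.
apply: mkl2E; apply: (@sqsum_dom _ N 0 (0 : l2)) => //; first exact: l2_sq.
by move=> k Nk; rewrite mul0r ltnNge Nk abs2_0.
Qed.

(** The squared norm of the tail is [nrm2 x] minus a partial sum. Truncations lie in the domain of
    every diagonal operator, which makes [model_dom] dense. *)
Lemma trunc2_dense x (e : R) : 0 < e -> exists N, nrm2 (x - trunc2 N x) < e.
Proof.
move=> e0; have /cvgrPdist_lt/(_ _ e0)[N _ /(_ N (leqnn N)) hN] := sqsum_cvg (l2_sq x).
have {}hN : `|nrm2 x - series (fun n => abs2 (x n)) N| < e by [].
exists N; apply: le_lt_trans hN; rewrite seriesEord ger0_norm ?subr_ge0 ?nrm2_ge//.
pose f i := if (i < N)%N then 0 else x i.
have fE i : (x - trunc2 N x) i = f i.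
  by rewrite l2_B trunc2E /f; case: ifP; rewrite ?subrr ?subr0.
apply: nrm2_le => n; under eq_bigr do rewrite fE.
rewrite lerBrDl; apply: le_trans (nrm2_ge x (N + n)).
rewrite big_split_ord/= lerD2l.
apply: le_trans (sum_abs2_nd f (leq_addl N n)) _.
rewrite big_split_ord/= big1 ?add0r => [|i _]; last first.
  by rewrite /f ltn_ord abs2_0.
by apply: ler_sum => i _; rewrite /f ltnNge leq_addr.
Qed.

End SquareSummable.

(** * The space [C x l2] and bounded linear maps on it *)

Section BoundedLinear.
Variable R : realType.

Definition hilb : lmodType R[i] := (R[i] * l2 R)%type.

Definition ipV (p q : hilb) : R[i] := p.1 * Num.conj q.1 + ip2 p.2 q.2.

Lemma hilbP (p q : hilb) : p.1 = q.1 -> p.2 = q.2 -> p = q.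
Proof. by case: p q => [? ?] [? ?] /= -> ->. Qed.

Lemma hilb_fst (a : R[i]) (p q : hilb) : (a *: p + q).1 = a * p.1 + q.1.
Proof. by []. Qed.

Lemma hilb_snd (a : R[i]) (p q : hilb) : (a *: p + q).2 = a *: p.2 + q.2.
Proof. by []. Qed.

(** The combination is that of [A x + t B x - l x] in the resolvent equation. *)
Lemma hilb_pencil1 (s t : R[i]) (p q r : hilb) :
  (p + s *: q - t *: r).1 = p.1 + s * q.1 - t * r.1.
Proof. by []. Qed.

Lemma l2_pencil (s t : R[i]) (x y z : l2 R) n :
  (x + s *: y - t *: z) n = x n + s * y n - t * z n.
Proof.
rewrite l2_B [x + _]addrC l2_lin -[t *: z]addr0 l2_lin l2_0 addr0.
by rewrite [s * _ + _]addrC.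
Qed.

Lemma hilb_pencil2 (s t : R[i]) (p q r : hilb) :
  (p + s *: q - t *: r).2 = p.2 + s *: q.2 - t *: r.2.
Proof. by []. Qed.

Definition nrmV (p : hilb) : R := abs2 p.1 + nrm2 p.2.

Lemma ip2Pr (a : R[i]) (x y z : l2 R) :
  ip2 z (a *: x + y) = Num.conj a * ip2 z x + ip2 z y.
Proof. by rewrite ip2C ip2P rmorphD rmorphM/= -!ip2C. Qed.

Lemma ip2_0l (x : l2 R) : ip2 0 x = 0.
Proof. by have := ip2P (-1) 0 0 x; rewrite scaler0 addr0 mulN1r addNr. Qed.

Lemma ip2Zl (a : R[i]) (x y : l2 R) : ip2 (a *: x) y = a * ip2 x y.
Proof. by rewrite -[X in ip2 X y]addr0 ip2P ip2_0l addr0. Qed.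

Lemma ipVxx p : ipV p p = (nrmV p)%:C.
Proof. by rewrite /ipV abs2E ip2xx -rmorphD. Qed.

Lemma ipV_hilbert : is_hilbert ipV.
Proof.
split.
- by move=> a x y z; rewrite /ipV hilb_fst hilb_snd ip2P; ring.
- by move=> x y; rewrite /ipV ip2C rmorphD rmorphM/= conjCK mulrC.
- by move=> x; rewrite ipVxx ler0c addr_ge0 ?abs2_ge0 ?nrm2_ge0.
- move=> [c u]; rewrite ipVxx => -[/eqP].
  rewrite /nrmV paddr_eq0 ?abs2_ge0 ?nrm2_ge0// => /andP[/eqP/abs2_eq0/= -> /eqP u0].
  by congr pair; case: (l2_hilbert R) => _ _ _ + _; apply; rewrite ip2xx u0.
- move=> u h.
  have {}h (e : R) : 0 < e -> exists N, forall m n, (N <= m)%N -> (N <= n)%N ->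
      nrmV (u m - u n) < e.
    move=> e0; have [|N hN] := h e%:C; first by rewrite ltcR.
    by exists N => m n Nm Nn; have := hN m n Nm Nn; rewrite /nsq ipVxx ltcR.
  have [|c hc] := @complex_complete _ (fun n => (u n).1).
    move=> e e0; have [N hN] := h e e0; exists N => m n Nm Nn.
    by apply: le_lt_trans (hN _ _ Nm Nn); rewrite lerDl nrm2_ge0.
  have [|l hl] := @l2_complete _ (fun n => (u n).2).
    move=> e e0; have [N hN] := h e e0; exists N => m n Nm Nn.
    by apply: le_lt_trans (hN _ _ Nm Nn); rewrite lerDr abs2_ge0.
  exists (c, l) => e; rewrite ltcE/= => /andP[/eqP Ie e0].
  have e2 : 0 < complex.Re e / 2 by rewrite divr_gt0.
  have [N1 h1] := hc _ e2; have [N2 h2] := hl _ e2.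
  exists (maxn N1 N2) => n; rewrite geq_max => /andP[/h1 n1 /h2 n2].
  rewrite /nsq ipVxx ltcE/= Ie eqxx/= /nrmV/=; lra.
Qed.

Lemma nrm2D_le (x y : l2 R) : nrm2 (x + y) <= 2 * nrm2 x + 2 * nrm2 y.
Proof.
have [h1 h2 h3 _ _] := l2_hilbert R.
by have := rformD_le (re_ip_form h1 h2 h3) x y; rewrite /re_ip !ip2xx.
Qed.

Lemma nrm2Z (a : R[i]) (x : l2 R) : nrm2 (a *: x) <= abs2 a * nrm2 x.
Proof. by apply: nrm2_dom; rewrite ?abs2_ge0// => n; rewrite -abs2M. Qed.

(** Real Cauchy-Schwarz for [x] and for [i x] bounds the real and the imaginary part of [<x, y>],
    whence the factor 2. *)
Lemma abs2_ip2_le (x y : l2 R) : abs2 (ip2 x y) <= 2 * nrm2 y * nrm2 x.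
Proof.
have [h1 h2 h3 _ _] := l2_hilbert R.
have hr := re_ip_form h1 h2 h3.
have cs1 := rform_cs hr x y.
have cs2 := rform_cs hr ((Complex 0 1 : R[i]) *: x) y.
have nI : nrm2 ((Complex 0 1 : R[i]) *: x) <= nrm2 x.
  apply: le_trans (nrm2Z _ _) _.
  by rewrite /abs2/= expr0n add0r expr1n mul1r.
move: cs1 cs2; rewrite /re_ip ip2Zl !ip2xx /abs2; case: (ip2 x y) => s t /=; rewrite mul0r mul1r sub0r sqrrN => cs1 cs2.
have := ler_wpM2r (nrm2_ge0 y) nI; nra.
Qed.

(** [N] stands for a squared norm, so one notion serves scalar and [l2] values. The closure lemmas
    below assemble the resolvent of the model from such maps. *)
Definition bounded_linear (U : lmodType R[i]) (N : U -> R) (F : hilb -> U) : Prop :=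
  (forall (a : R[i]) p q, F (a *: p + q) = a *: F p + F q) /\
  exists2 K : R, 0 <= K & forall p, N (F p) <= K * nrmV p.

Local Notation blC := (@bounded_linear R[i] (@abs2 R)).
Local Notation bl2 := (@bounded_linear (l2 R) (@nrm2 R)).

Lemma bl_fst : blC (fun p => p.1).
Proof. by split=> //; exists 1 => // p; rewrite mul1r lerDl nrm2_ge0. Qed.

Lemma bl_snd : bl2 (fun p => p.2).
Proof. by split=> //; exists 1 => // p; rewrite mul1r lerDr abs2_ge0. Qed.

Lemma bl_add (U : lmodType R[i]) (N : U -> R) F G :
  (forall x y, N (x + y) <= 2 * N x + 2 * N y) ->
  bounded_linear N F -> bounded_linear N G -> bounded_linear N (fun p => F p + G p).
Proof.
move=> ND [Fl [K K0 hK]] [Gl [L L0 hL]]; split.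
  by move=> a p q; rewrite Fl Gl scalerDr addrACA.
exists (2 * K + 2 * L); first by lra.
move=> p; apply: le_trans (ND _ _) _; have := hK p; have := hL p; lra.
Qed.

Lemma bl_comp (U W : lmodType R[i]) (N : U -> R) (N' : W -> R) (L : U -> W) (M : R) F :
  (forall (a : R[i]) x y, L (a *: x + y) = a *: L x + L y) -> 0 <= M ->
  (forall x, N' (L x) <= M * N x) ->
  bounded_linear N F -> bounded_linear N' (fun p => L (F p)).
Proof.
move=> Ll M0 hL [Fl [K K0 hK]]; split; first by move=> a p q; rewrite Fl Ll.
exists (M * K); first exact: mulr_ge0.
by move=> p; apply: le_trans (hL _) _; rewrite -mulrA ler_wpM2l.
Qed.

Lemma bl_coord F m : bl2 F -> blC (fun p => F p m).
Proof.
apply: (bl_comp (L := fun x : l2 R => x m) (M := 1)) => //.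
by move=> x; rewrite mul1r abs2_le_nrm2.
Qed.

Lemma bl_vec F (x : l2 R) : blC F -> bl2 (fun p => F p *: x).
Proof.
apply: (bl_comp (L := fun z : R[i] => z *: x) (M := nrm2 x)); last 2 first.
- exact: nrm2_ge0.
- by move=> z; rewrite mulrC nrm2Z.
- by move=> a y z; rewrite scalerDl -scalerA.
Qed.

Lemma bl_cst F (k : R[i]) : blC F -> blC (fun p => k * F p).
Proof.
apply: (bl_comp (L := fun z : R[i] => k * z) (M := abs2 k)); last 2 first.
- exact: abs2_ge0.
- by move=> z; rewrite abs2M.
- by move=> a y z; rewrite -[RHS]/(a * (k * y) + k * z) mulrCA -mulrDr.
Qed.

Lemma bl_ip F (y : l2 R) : bl2 F -> blC (fun p => ip2 (F p) y).
Proof.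
apply: (bl_comp (L := fun x : l2 R => ip2 x y) (M := 2 * nrm2 y)).
- by move=> a x z; rewrite ip2P.
- by rewrite mulr_ge0 ?nrm2_ge0.
- by move=> x; exact: abs2_ip2_le.
Qed.

Lemma bl_pair F G : blC F -> bl2 G -> bounded_op ipV (fun p => (F p, G p) : hilb).
Proof.
move=> [Fl [K K0 hK]] [Gl [L L0 hL]]; split.
  by move=> a p q; rewrite Fl Gl.
exists (K + L)%:C => p; rewrite /nsq !ipVxx -rmorphM lecR /nrmV/= mulrDl.
exact: lerD.
Qed.

(** Serves both for bounded [d] and, on [model_dom], for the unbounded diagonal operator; the value
    is 0 where the product is not square-summable. *)
Definition diag2 (d : nat -> R) (x : l2 R) : l2 R := mkl2 (fun n => (d n)%:C * x n).

Section Diag.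
Variables (d : nat -> R) (M : R).
Hypothesis M0 : 0 <= M.
Hypothesis dM : forall n, d n ^+ 2 <= M.

Lemma diag2E x n : diag2 d x n = (d n)%:C * x n.
Proof.
apply: (@mkl2E _ (fun n => (d n)%:C * x n)); apply: (@sqsum_dom _ 0 M x) => //; first exact: l2_sq.
by move=> k _; rewrite abs2M abs2_real ler_wpM2r ?abs2_ge0.
Qed.

Lemma bl_diag F : bl2 F -> bl2 (fun p => diag2 d (F p)).
Proof.
apply: (bl_comp (L := diag2 d) (M := M)) => //.
  by move=> a x y; apply: l2P => n; rewrite l2_lin !diag2E l2_lin; ring.
move=> x; apply: nrm2_dom => // n.
by rewrite diag2E abs2M abs2_real ler_wpM2r ?abs2_ge0.
Qed.

End Diag.

End BoundedLinear.

(** * The model operator *)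

Section Model.
Variables (R : realType) (a w : nat -> R) (v : l2 R).
Hypothesis vw : forall n, v n = (w n)%:C.

Local Notation H := (hilb R).

Definition model_dom : set H := [set p : H | (fun n => (a n)%:C * (p.2 : l2 R) n) \in @sqsum R].

Definition model_A (p : H) : H := (ip2 p.2 v, p.1 *: v + diag2 a p.2).

Definition model_B (p : H) : H := (p.1, 0).

Lemma diag2_dom (x : l2 R) n : (fun n => (a n)%:C * x n) \in @sqsum R ->
  diag2 a x n = (a n)%:C * x n.
Proof. exact: (@mkl2E _ (fun n => (a n)%:C * x n)). Qed.

Lemma model_A2 p n : model_dom p -> (model_A p).2 n = p.1 * v n + (a n)%:C * p.2 n.
Proof. by move=> Dp; rewrite l2_lin diag2_dom. Qed.

Lemma model_A1 p : (model_A p).1 = ip2 p.2 v.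
Proof. by []. Qed.

Lemma model_B1 p : (model_B p).1 = p.1.
Proof. by []. Qed.

Lemma model_B2 p n : (model_B p).2 n = 0.
Proof. by []. Qed.

Lemma conj_real (s : R) : Num.conj (s%:C : R[i]) = s%:C.
Proof. exact: conjc_real. Qed.

Lemma diag2_sym (x y : l2 R) : (fun n => (a n)%:C * x n) \in @sqsum R ->
  (fun n => (a n)%:C * y n) \in @sqsum R ->
  ip2 (diag2 a x) y = ip2 x (diag2 a y).
Proof.
move=> hx hy; rewrite /ip2; congr csum; apply/funext => n.
rewrite (diag2_dom n hx) (diag2_dom n hy) rmorphM/= conj_real; ring.
Qed.

Lemma model_dom_subspace : Defs.subspace model_dom.
Proof.
split=> [|b p q Dp Dq].
  apply/sqsumP; exists 0 => n; rewrite big1// => i _.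
  by rewrite l2_0 mulr0 abs2_0.
suff E : (fun n => (a n)%:C * (b *: p + q).2 n) =
    (fun n => b * ((a n)%:C * p.2 n) + (a n)%:C * q.2 n).
  by rewrite /model_dom /= E; exact: sqsumP_lin.
by apply/funext => n; rewrite hilb_snd l2_lin; ring.
Qed.

Lemma model_A_lin (b : R[i]) p q : model_dom p -> model_dom q ->
  model_A (b *: p + q) = b *: model_A p + model_A q.
Proof.
move=> Dp Dq; have Ds := model_dom_subspace.2 b _ _ Dp Dq.
apply: hilbP.
  by rewrite -[LHS]/(ip2 _ v) hilb_snd ip2P.
apply: l2P => n; rewrite (model_A2 n Ds) !hilb_snd hilb_fst !l2_lin.
by rewrite (diag2_dom n Dp) (diag2_dom n Dq); ring.
Qed.

Lemma model_A_sym p q : model_dom p -> model_dom q ->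
  ipV (model_A p) q = ipV p (model_A q).
Proof.
move=> Dp Dq; rewrite /ipV /model_A/=.
rewrite ip2P ip2Pr diag2_sym// (ip2C q.2 v); ring.
Qed.

Lemma dom_delta n : model_dom (0, delta2 R n).
Proof.
apply: (@sqsum_dom _ n.+1 0 (0 : l2 R)) => //; first exact: l2_sq.
by move=> k nk; rewrite /= delta2E gtn_eqF// mulr0 abs2_0 mul0r.
Qed.

Lemma model_A_delta n :
  model_A (0, delta2 R n) = ((w n)%:C, (a n)%:C *: delta2 R n).
Proof.
apply: hilbP.
  by rewrite /= ip2C ip2_deltar vw conj_real.
apply: l2P => k; rewrite -[LHS]/((model_A (0, delta2 R n)).2 k).
rewrite model_A2; last exact: dom_delta.
rewrite -[RHS]/((a n)%:C * delta2 R n k) /= mul0r add0r delta2E.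
by case: eqP => [->//|_]; rewrite !mulr0.
Qed.

Lemma model_A_sa : self_adjoint (@ipV R) model_dom model_A.
Proof.
split.
- split; [exact: model_dom_subspace | exact: model_A_lin].
- move=> [c u] e; rewrite ltcE/= => /andP[/eqP Ie e0].
  have [N hN] := trunc2_dense u e0.
  exists (c, trunc2 N u).
    apply: (@sqsum_dom _ N 0 (0 : l2 R)) => //; first exact: l2_sq.
    by move=> k Nk; rewrite /= trunc2E ltnNge Nk mulr0 abs2_0 mul0r.
  rewrite /nsq ipVxx ltcE/= Ie eqxx/= /nrmV/=.
  by rewrite subrr abs2_0 add0r.
- move=> y; split=> [[z hz]|Dy]; last first.
    by exists (model_A y) => x Dx; exact: model_A_sym.
  (* Testing the adjoint relation on [(0, delta2 R n)] computes [a n * y.2 n] coordinatewise, so any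
     [y] in the adjoint domain lies in [model_dom]. *)
  suff E : (fun n => (a n)%:C * y.2 n) = (fun n => - y.1 * v n + z.2 n).
    by rewrite /model_dom/= E; apply: sqsumP_lin; exact: l2_sq.
  apply/funext => n; have := hz _ (dom_delta n).
  rewrite model_A_delta /ipV/= ip2Zl mul0r add0r.
  rewrite (ip2C y.2) (ip2C z.2) !ip2_deltar => /(congr1 Num.conj).
  rewrite rmorphD !rmorphM/= !conjCK !conj_real => <-.
  rewrite vw; ring.
- exact: model_A_sym.
Qed.

Lemma model_B_bounded : bounded_op (@ipV R) model_B.
Proof.
split=> [b p q|]; first by rewrite /model_B; congr pair; rewrite /= scaler0 addr0.
exists 1 => p; rewrite mul1r /nsq !ipVxx lecR /nrmV/= lerD2l.
apply: (@le_trans _ _ 0); last exact: nrm2_ge0.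
by apply: nrm2_le => n; rewrite big1// => i _; rewrite l2_0 abs2_0.
Qed.

Lemma model_B_sym p q : ipV (model_B p) q = ipV p (model_B q).
Proof. by rewrite /ipV /= ip2_0l (ip2C 0) ip2_0l rmorph0. Qed.

Lemma model_B_sa : self_adjoint (@ipV R) setT model_B.
Proof.
split.
- by split; [split | move=> b p q _ _; exact: model_B_bounded.1].
- move=> p e e0; exists p => //; rewrite subrr /nsq.
  by case: (ipV_hilbert R) => /(_ (-1) 0 0 0); rewrite scaler0 addr0 mulN1r addNr => ->.
- by move=> y; split=> // _; exists (model_B y) => x _; exact: model_B_sym.
- by move=> x y _ _; exact: model_B_sym.
Qed.

Lemma model_B_nonneg : nonneg_op (@ipV R) model_B.
Proof. by move=> p; rewrite /ipV /= ip2_0l addr0 abs2E ler0c abs2_ge0. Qed.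

Lemma model_pencilE t l p n : model_dom p ->
  (model_A p + t%:C *: model_B p - l%:C *: p).2 n =
    p.1 * v n + ((a n)%:C - l%:C) * p.2 n.
Proof.
by move=> Dp; rewrite hilb_pencil2 l2_pencil (model_A2 n Dp) model_B2; ring.
Qed.

Lemma model_pencil1 t l p :
  (model_A p + t%:C *: model_B p - l%:C *: p).1 =
    ip2 p.2 v + (t%:C - l%:C) * p.1.
Proof. by rewrite hilb_pencil1 model_A1 model_B1; ring. Qed.

(** * The resolvent at an isolated coupled diagonal entry *)

Section InGap.
Variables (m : nat) (e : R).
Hypothesis wm : w m != 0.
Hypothesis e0 : 0 < e.
Hypothesis sep : forall n, n != m -> e <= `|a n - a m|.

(** The reduced resolvent of the diagonal at [a m], set to 0 at the singular index and bounded by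
    the separation [e]. *)
Let d n := if n == m then 0 else (a n - a m)^-1.
Let k : R[i] := ((w m)^-1)%:C.

Let d_bnd n : d n ^+ 2 <= e^-1 ^+ 2.
Proof.
rewrite /d; case: eqVneq => [_|nm]; first by rewrite expr0n sqr_ge0.
rewrite -real_normK ?num_real// ler_pXn2r ?nnegrE ?invr_ge0 ?(ltW e0)//.
by rewrite normfV lef_pV2 ?posrE ?sep// (lt_le_trans e0 (sep nm)).
Qed.

Let dE := diag2E (sqr_ge0 e^-1) d_bnd.

Let kw : k * (w m)%:C = 1.
Proof. by rewrite -rmorphM/= mulVf. Qed.

(** Solves [(A + t B - a m) (c, u) = p]. Coordinate [m] of the second component reads
    [c w m = p.2 m] and gives [c]; the other coordinates give [u] off [m] as [su]; the first
    component then fixes [u m] as [ss], whatever [t] is. Signs are written [- 1 *] to match the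
    closure lemmas for bounded maps. *)
Let sc (p : H) : R[i] := k * p.2 m.
Let su (p : H) : l2 R := diag2 d (p.2 + (- 1 * sc p) *: v).
Let ss (t : R) (p : H) : R[i] :=
  k * (p.1 + ((a m - t)%:C * sc p + - 1 * ip2 (su p) v)).
Let S t (p : H) : H := (sc p, su p + ss t p *: delta2 R m).

Let S_bounded t : bounded_op (@ipV R) (S t).
Proof.
have bc : bounded_linear (@abs2 R) sc by apply/bl_cst/bl_coord/bl_snd.
have bu : bounded_linear (@nrm2 R) su.
  apply: (bl_diag (sqr_ge0 e^-1) d_bnd); apply: bl_add.
  - exact: nrm2D_le.
  - exact: bl_snd.
  - by apply/bl_vec/bl_cst.
apply: bl_pair => //; apply: bl_add => //; first exact: nrm2D_le.
apply/bl_vec/bl_cst/bl_add; [exact: abs2D_le | exact: bl_fst |].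
apply: bl_add; [exact: abs2D_le | exact: bl_cst |].
by apply/bl_cst/bl_ip.
Qed.

Let S2 t p n : ((a n)%:C - (a m)%:C) * (S t p).2 n = p.2 n - sc p * v n.
Proof.
rewrite -[(S t p).2 n]/(su p n + ss t p * delta2 R m n) delta2E.
rewrite dE /d -[(p.2 + _) n]/(p.2 n + (- 1 * sc p) * v n).
case: eqVneq => [->|nm].
  rewrite subrr mul0r vw /sc mulrAC kw; ring.
rewrite mulr0 addr0 mulrA -rmorphB -rmorphM/= mulfV; last first.
  by rewrite -normr_gt0 (lt_le_trans e0 (sep nm)).
rewrite rmorph1; ring.
Qed.

Lemma model_in_gap t :
  in_resolvent (@ipV R) model_dom (fun p => model_A p + t%:C *: model_B p) (a m)%:C.
Proof.
have ipd : ip2 (delta2 R m) v = (w m)%:C by rewrite ip2C ip2_deltar vw conj_real.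
exists (S t); split=> [|p|p Dp]; first exact: S_bounded.
  have DS : model_dom (S t p).
    (* By [S2], multiplying by [a n] differs from multiplying by the constant [a m] only by
       square-summable terms. *)
    suff E : (fun n => (a n)%:C * (S t p).2 n) =
        (fun n => (a m)%:C * (S t p).2 n + (- sc p * v n + p.2 n)).
      rewrite /model_dom/= E; apply: sqsumP_lin; first exact: l2_sq.
      by apply: sqsumP_lin; exact: l2_sq.
    apply/funext => n; have := S2 t p n; rewrite mulrBl => /eqP.
    by rewrite subr_eq => /eqP ->; ring.
  have S1 : (S t p).1 = sc p by [].
  split=> //; apply: hilbP.
    have S2v : (S t p).2 = ss t p *: delta2 R m + su p by rewrite addrC.
    have ssw : ss t p * (w m)%:C =
        p.1 + ((a m - t)%:C * sc p + - 1 * ip2 (su p) v).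
      by rewrite /ss mulrAC kw mul1r.
    by rewrite model_pencil1 S1 S2v ip2P ipd ssw rmorphB; ring.
  by apply: l2P => n; rewrite model_pencilE// S2 S1; ring.
set y := _ - _.
have y2 n : y.2 n = p.1 * v n + ((a n)%:C - (a m)%:C) * p.2 n by exact: model_pencilE.
have y1 : y.1 = ip2 p.2 v + (t%:C - (a m)%:C) * p.1 by exact: model_pencil1.
(* For the left inverse, [sc y] recovers [p.1], [su y] recovers [p.2] off index [m], and [ss t y]
   recovers [p.2 m]. *)
clearbody y; have cE : sc y = p.1.
  by rewrite /sc y2 subrr mul0r addr0 vw mulrCA kw mulr1.
have uE : p.2 = su y + p.2 m *: delta2 R m.
  apply: l2P => n; rewrite -[RHS]/(su y n + p.2 m * delta2 R m n) delta2E dE /d.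
  rewrite [y.2 + _]addrC l2_lin y2 cE.
  case: eqVneq => [->|nm]; first by rewrite mul0r add0r mulr1.
  rewrite (_ : _ * v n + _ = ((a n)%:C - (a m)%:C) * p.2 n); last by ring.
  rewrite mulr0 addr0 mulrA -rmorphB -rmorphM/= mulVf ?mul1r//.
  by rewrite -normr_gt0 (lt_le_trans e0 (sep nm)).
have sE : ss t y = p.2 m.
  rewrite /ss y1 cE {1}uE [X in ip2 X v]addrC ip2P ipd rmorphB/=.
  rewrite (_ : _ + _ + _ = p.2 m * (w m)%:C); last by ring.
  by rewrite mulrCA kw mulr1.
by rewrite /S cE sE -uE; case: (p).
Qed.

End InGap.

(** Boundedness of the resolvent at [t = 0] keeps [a n] away from [l]; then
    [u n = - w n / (a n - l)] is square-summable, and [(1, u)] is an eigenvector of [A + t B] for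
    [l] at a suitable real [t]. *)
Lemma model_notin_gap (l : R) : (forall n, a n = l -> w n = 0) ->
  ~ gap_set (@ipV R) model_dom model_A model_B l.
Proof.
move=> al gap.
have res t : in_resolvent (@ipV R) model_dom
    (fun x => model_A x + t%:C *: model_B x) l%:C.
  by apply: contrapT => h; exact: (gap t h).
have [h1 h2 h3 _ _] := ipV_hilbert R.
have [S [Sb _ S2]] := res 0.
have [K K0 hK] := bounded_op_re h1 h2 h3 Sb.
(* Apply the resolvent bound to [(A - l) (0, delta2 R n)], whose squared norm is
   [w n ^+ 2 + (a n - l) ^+ 2]. *)
have lower n : 1 <= K * (w n ^+ 2 + (a n - l) ^+ 2).
  have := S2 _ (dom_delta n).
  set y := (_ - _ : H) => Sy.
  have y1 : y.1 = (w n)%:C.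
    rewrite /y model_pencil1 -[((0, delta2 R n) : H).2]/(delta2 R n) -[((0, delta2 R n) : H).1]/(0 : R[i]) mulr0 addr0.
    by rewrite ip2C ip2_deltar vw conj_real.
  have y2 : y.2 = (a n - l)%:C *: delta2 R n.
    apply: l2P => k; rewrite /y (model_pencilE _ _ _ (dom_delta n)).
    rewrite -[((0, delta2 R n) : H).2]/(delta2 R n) -[((0, delta2 R n) : H).1]/(0 : R[i]) mul0r add0r.
    rewrite -[(_ *: delta2 R n)]addr0 l2_lin l2_0 addr0 delta2E rmorphB/=.
    by case: eqP => [->//|_]; rewrite !mulr0.
  have := hK y; rewrite Sy /re_ip !ipVxx => hy.
  have {}hy : nrmV ((0, delta2 R n) : H) <= K * nrmV y := hy.
  move: hy; rewrite {1}/nrmV abs2_0 nrm2_delta add0r => /le_trans; apply.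
  apply: ler_wpM2l => //; rewrite /nrmV y1 y2 abs2_real lerD2l.
  by apply: le_trans (nrm2Z _ _) _; rewrite nrm2_delta mulr1 abs2_real.
have K_gt0 : 0 < K.
  rewrite lt_neqAle K0 andbT; apply/eqP => K00.
  by have := lower 0%N; rewrite -K00 mul0r; lra.
have al0 n : a n - l != 0.
  rewrite subr_eq0; apply/eqP => anl; have := lower n.
  by rewrite (al n anl) anl subrr expr0n addr0 mulr0; lra.
have K2 : 0 < (2 * K)^-1 by rewrite invr_gt0; lra.
(* Once [w n ^+ 2 < 1 / (2 K)], [lower] leaves at least half for [K * (a n - l) ^+ 2], so
   [f n ^+ 2 <= 2 K * w n ^+ 2]. *)
have /cvgrPdist_lt/(_ _ K2)[N _ hN] := cvg_series_cvg_0 (sqsum_cvg (l2_sq v)).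
pose f n : R := - (w n / (a n - l)).
have fsq : (fun n => (f n)%:C) \in @sqsum R.
  apply: (@sqsum_dom _ N (2 * K) v); [exact: l2_sq | lra | move=> n Nn].
  have {}hN : `|0 - abs2 (v n)| < (2 * K)^-1 := hN n Nn.
  move: hN; rewrite vw !abs2_real sub0r normrN ger0_norm ?sqr_ge0// => wK.
  have {}wK : K * w n ^+ 2 <= 1 / 2.
    have : K * w n ^+ 2 <= K * (2 * K)^-1 by rewrite ler_pM2l// ltW.
    by rewrite (_ : K * (2 * K)^-1 = 1 / 2)//; field; rewrite gt_eqF.
  rewrite /f sqrrN expr_div_n ler_pdivrMr; last first.
    by rewrite lt_def sqr_ge0 expf_neq0 ?al0.
  have h : 1 <= 2 * K * (a n - l) ^+ 2 by have := lower n; lra.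
  by have := ler_wpM2l (sqr_ge0 (w n)) h; lra.
pose u : l2 R := mkl2 (fun n => (f n)%:C).
have uE n : u n = (f n)%:C by exact: (mkl2E _ fsq).
have fE n : (a n - l) * f n = - w n by rewrite /f; field.
have Du : model_dom (1, u).
  suff E : (fun n => (a n)%:C * u n) = (fun n => l%:C * u n + (- 1 * v n + (0 : l2 R) n)).
    rewrite /model_dom/= E; apply: sqsumP_lin; first exact: l2_sq.
    by apply: sqsumP_lin; exact: l2_sq.
  apply/funext => n; rewrite l2_0 addr0 uE vw mulN1r -rmorphN -!rmorphM/= -rmorphD/=.
  by congr (_%:C); have := fE n; lra.
have uvE : ip2 u v = (complex.Re (ip2 u v))%:C.
  have : ip2 u v = Num.conj (ip2 u v).
    rewrite -ip2C /ip2; congr csum; apply/funext => n.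
    by rewrite uE vw !conj_real mulrC.
  by case: (ip2 u v) => r s [h]; congr Complex; lra.
(* This [t] annihilates the first component of [(A + t B - l) (1, u)]; it is real because [u] and
   [v] have real coordinates. *)
have [S' [S'b _ S'2]] := res (l - complex.Re (ip2 u v)).
have := S'2 _ Du.
have -> : model_A (1, u) + (l - complex.Re (ip2 u v))%:C *: model_B (1, u)
    - l%:C *: (1, u) = 0 :> H.
  apply: hilbP.
    rewrite model_pencil1 -[((1, u) : H).2]/u -[((1, u) : H).1]/(1 : R[i]) mulr1 {1}uvE.
    by rewrite rmorphB addrAC subrr add0r subrr.
  apply: l2P => n; rewrite (model_pencilE _ _ _ Du) -[((1, u) : H).2]/u -[((1, u) : H).1]/(1 : R[i]).
  rewrite mul1r vw uE -rmorphB -rmorphM/= fE rmorphN subrr; exact: esym (l2_0 R n).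
move=> E; have := etrans (esym E) (real_linear0 (bounded_op_real_linear S'b)).
by move/(congr1 fst) => /= /eqP; rewrite oner_eq0.
Qed.

End Model.

(** * Realising a given discrete set *)

Lemma half_powers_sqsum (R : realType) (w : nat -> R) :
  (forall n, w n ^+ 2 <= (1 / 2) ^+ n) -> (fun n => (w n)%:C) \in @sqsum R.
Proof.
move=> hw; apply/sqsumP; exists 2 => n.
(* The sharper bound, the geometric sum itself, is what the induction carries. *)
apply: le_trans (_ : 2 - 2 * (1 / 2) ^+ n <= _); last first.
  by have : 0 <= (1 / 2 : R) ^+ n by [apply: exprn_ge0; lra]; lra.
elim: n => [|n IH]; first by rewrite big_ord0 expr0; lra.
rewrite big_ord_recr/= abs2_real [(1 / 2) ^+ n.+1]exprS.
by have := hw n; lra.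
Qed.

Lemma discrete_not_setT (R : realType) (P : set R) : discrete_set P ->
  exists q, ~ P q.
Proof.
move=> [_ iso]; apply: contrapT => h.
have PT x : P x by apply: contrapT => Px; apply: h; exists x.
have [e e0 he] := iso 0 (PT 0).
have := he (e / 2) (PT _); rewrite subr0 gtr0_norm ?divr_gt0// => E.
have : e / 2 = 0 by apply: E; lra.
lra.
Qed.

Lemma discrete_is_gap_set (R : realType) (P : set R) : discrete_set P ->
  exists (V : lmodType R[i]) (ip : V -> V -> R[i]), is_hilbert ip /\
  exists (D : set V) (A B : V -> V),
    [/\ self_adjoint ip D A, self_adjoint ip setT B, bounded_op ip B,
        nonneg_op ip B & P = gap_set ip D A B].
Proof.
move=> Pd; have [q Pq] := discrete_not_setT Pd.
have [/countable_injP[f finj] iso] := Pd.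
pose hit n := `[< exists2 x, P x & f x = n >].
(* Indices outside the enumeration get a point [q] outside [P] and a zero
   coupling coefficient, so that they only add [q] to every spectrum. *)
have /choice[a aP] n : exists x, if hit n then P x /\ f x = n else x = q.
  rewrite /hit; case: asboolP => [[x Px fx]|_]; first by exists x.
  by exists q.
pose w n : R := if hit n then (1 / 2) ^+ n else 0.
have wsq : (fun n => (w n)%:C) \in @sqsum R.
  apply: half_powers_sqsum => n; rewrite /w; case: (hit n); last first.
    by rewrite expr0n; apply: exprn_ge0; lra.
  rewrite expr2 ler_piMr//; first by apply: exprn_ge0; lra.
  by apply: exprn_ile1; lra.
pose v := mkl2 (fun n => (w n)%:C).
have vw n : v n = (w n)%:C by exact: (mkl2E _ wsq).
exists (hilb R), (@ipV R); split; first exact: ipV_hilbert.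
exists (model_dom a), (model_A a v), (@model_B R); split.
- exact: model_A_sa vw.
- exact: model_B_sa.
- exact: model_B_bounded.
- exact: model_B_nonneg.
apply/seteqP; split=> [l Pl t|l gap]; last first.
  (* For [l] outside [P], the equality [a n = l] occurs only at filler indices, where [w n = 0]. *)
  apply: contrapT => nPl; apply: (model_notin_gap (l := l) vw) gap => n anl.
  have := aP n; rewrite /w; case: (hit n) => // -[]; rewrite anl => Pl.
  by have := nPl Pl.
have hl : hit (f l) by apply/asboolP; exists l.
have al : a (f l) = l.
  have := aP (f l); rewrite hl => -[Pa fa].
  by apply: finj fa; rewrite inE.
have wl : w (f l) != 0 by rewrite /w hl expf_neq0//; lra.
have [e e0 he] := iso l Pl.
(* The entries other than [l] are either points of [P], at distance at least [e], or the filler [q],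
   which differs from [l] because it is outside [P]. *)
pose d := Num.min e `|q - l|.
have d0 : 0 < d.
  rewrite /d lt_min e0 normr_gt0 subr_eq0; apply/eqP => ql.
  by apply: Pq; rewrite ql.
have sep n : n != f l -> d <= `|a n - a (f l)|.
  move=> nl; rewrite al /d ge_min; have := aP n; case: (hit n) => [[Pa fa]|->].
    apply/orP; left; rewrite leNgt; apply/negP => /(he _ Pa) E.
    by move: nl; rewrite -fa E eqxx.
  by rewrite lexx orbT.
by apply; rewrite -al; exact: (model_in_gap vw wl d0 sep).
Qed.

Unset Implicit Arguments.

Theorem theorem1p1 (R : realType) :
  (forall (V : lmodType R[i]) (ip : V -> V -> R[i]), is_hilbert ip ->
   forall (D : set V) (A B : V -> V),
     self_adjoint ip D A ->
     self_adjoint ip setT B -> bounded_op ip B -> nonneg_op ip B ->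
     (exists x, B x != 0) ->
     discrete_set (gap_set ip D A B) /\
     dense_in_R [set r : R | exists t : R,
        spectrum ip D (fun x => A x + (t%:C)%C *: B x) (r%:C)%C])
  /\
  (forall P : set R, discrete_set P ->
   exists (V : lmodType R[i]) (ip : V -> V -> R[i]), is_hilbert ip /\
   exists (D : set V) (A B : V -> V),
     [/\ self_adjoint ip D A, self_adjoint ip setT B, bounded_op ip B,
         nonneg_op ip B & P = gap_set ip D A B]).
Proof.
split=> [V ip Hip D A B A_sa B_sa B_bd B_nn Bnz|]; last exact: discrete_is_gap_set.
by split; [exact: gap_discrete | exact: union_spectra_dense].
Qed.
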